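(* Let $c_0\in(0,1)$ and let $\gamma_{c_0}\subset S^2$ be either of the two latitude circles determined by $\sin\phi=c_0$. For $N\ge1$ define the measure on $[-1,1]$ $$\mu_{N,c_0}=\frac{1}{c_0(N+\frac12)}\sum_{m=-N}^{N}\|Y^m_N\|^2_{L^2(\gamma_{c_0})}\,\delta_0\!\left(t-\frac mN\right).$$ Then for all $f\in C^0([-1,1])$, $$\lim_{N\to\infty}\int f(t)\,d\mu_{N,c_0}(t)=\frac{1}{c_0\pi}\int_{-c_0}^{c_0}f(t)\left(1-\left(\frac{t}{c_0}\right)^2\right)^{-1/2}dt.$$
   Context: $S^2$ is the round unit sphere with polar coordinates $(\phi,\theta)\in(0,\pi)\times(0,2\pi)$, $\phi$ being the angle from the north pole. $Y^m_N$, $-N\le m\le N$, are the standard spherical harmonics of degree $N$ and order $m$, $Y^m_N(\phi,\theta)=\sqrt{\frac{2N+1}{4\pi}\frac{(N-m)!}{(N+m)!}}\,P^m_N(\cos\phi)e^{im\theta}$ with $P^m_N$ the associated Legendre functions, normalized to have norm $1$ in $L^2(S^2)$. $L^2(\gamma_{c_0})$ is taken with respect to arc length on $\gamma_{c_0}$. $\delta_0(t-a)$ is the unit point mass at $t=a$. *)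

(* Defs.v *)
From HB Require Import structures.
From mathcomp Require Import all_boot all_order all_algebra.
From mathcomp Require Import complex.
From mathcomp Require Import all_classical all_reals all_analysis.

Set Implicit Arguments.
Unset Strict Implicit.
Unset Printing Implicit Defensive.

Import Order.TTheory GRing.Theory Num.Theory.
Import numFieldNormedType.Exports.

Local Open Scope classical_set_scope.
Local Open Scope ring_scope.
Local Open Scope complex_scope.

(* Rodrigues' formula, with the Condon-Shortley phase:
     P^m_N(x) = (-1)^m / (2^N N!) (1 - x^2)^(m/2) (d/dx)^(N+m) (x^2 - 1)^N.
   It covers all -N <= m <= N at once, the case m < 0 included; outside that
   range the value is meaningless, because of the absolute value absz (N + m). *)
Definition assoc_legendre (R : realType) (N : nat) (m : int) (x : R) : R :=
  (-1) ^ m / (2 ^+ N * (N`!)%:R) * Num.sqrt (1 - x ^+ 2) ^ m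
  * ((('X ^+ 2 - 1) ^+ N)^`(absz (N%:Z + m))).[x].

Definition expi (R : realType) (t : R) : R[i] := cos t +i* sin t.

(* Y^m_N (phi, theta), meaningful for -N <= m <= N and 0 < phi < pi; on that
   range absz is the identity on N - m and N + m. *)
Definition sph_harm (R : realType) (N : nat) (m : int) (phi theta : R) : R[i] :=
  (Num.sqrt ((2 * N%:R + 1) / (4 * pi)
             * ((absz (N%:Z - m))`!)%:R / ((absz (N%:Z + m))`!)%:R)
   * assoc_legendre N m (cos phi))%:C * expi (m%:~R * theta).

Definition sphere_pt (R : realType) (phi theta : R) (i : 'I_3) : R :=
  [:: sin phi * cos theta; sin phi * sin theta; cos phi]`_i.

(* Arc length element ds/dtheta along the latitude circle of polar angle phi. *)
Definition latitude_speed (R : realType) (phi theta : R) : R :=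
  Num.sqrt (\sum_(i < 3) derive1 (fun s : R => sphere_pt phi s i) theta ^+ 2).

(* L^2 norm, with respect to arc length, of the restriction to the latitude
   circle of polar angle phi of a function u given in polar coordinates. *)
Definition latitude_L2norm (R : realType) (phi : R) (u : R -> R -> R[i]) : R :=
  Num.sqrt (\int[@lebesgue_measure R]_(theta in `]0, (2 * pi)[)
    (ComplexField.Normc.normc (u phi theta) ^+ 2 * latitude_speed phi theta)).

Lemma mu_factor_ge0 (R : realType) (c0 : R) (N : nat) :
  0 < c0 -> 0 <= (c0 * (N%:R + 2^-1))^-1.
Proof.
by move=> c0_gt0; rewrite invr_ge0 mulr_ge0 ?addr_ge0 ?invr_ge0 ?(ltW c0_gt0).
Qed.

(* mu_{N,c0}, for the latitude circle of polar angle phi; the order is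
   m = k - N with 0 <= k < 2N + 1. As a measure on the real line it is carried
   by [-1, 1]. *)
Definition mu (R : realType) (c0 : R) (c0_gt0 : 0 < c0) (phi : R) (N : nat) :
    {measure set (measurableTypeR R) -> \bar R} :=
  mscale (NngNum (mu_factor_ge0 N c0_gt0))
    (msum (fun k : nat =>
       let m := k%:Z - N%:Z in
       mscale (NngNum (sqr_ge0 (latitude_L2norm phi (sph_harm N m))))
         (dirac (m%:~R / N%:R : measurableTypeR R)))
     (2 * N + 1)%N).

(* Main.v *)
Require Import Defs.
From mathcomp Require Import all_boot all_order all_algebra.
From mathcomp Require Import ring lra zify complex.
From mathcomp Require Import all_classical all_reals all_analysis.
From mathcomp Require Import measurable_realfun.

Import Order.TTheory GRing.Theory Num.Theory.
Import numFieldNormedType.Exports.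

Local Open Scope classical_set_scope.
Local Open Scope ring_scope.

(** Put c = cos (phi / 2) and d = sin (phi / 2). The group SU(2) acts on
    polynomials of degree at most n = 2N, and a rotation by phi sends the
    monomial t^a to (c t - d)^a (d t + c)^(n - a). Taylor expansion at cos phi
    turns Rodrigues' formula into the statement that the functions Y^m_N at
    polar angle phi are, up to sign and normalization, the coefficients of the
    rotated middle monomial
      q = (c t - d)^N (d t + c)^N
    (assoc_legendre_rot_mono): the mass that the measure puts at m/N is
      'C(2N, N) / 'C(2N, N + m) * (coefficient of t^(N + m) in q)^2
    (latitude_L2norm_order_weight), so the measure is the law of the angular
    momentum J_z, divided by N, in the rotation of the state of weight 0.

    Moments. The form sum_j p_j q_j / 'C(n, j) is invariant under the rotation
    (bombieri_rot_mono), and the operator t d/dt - N, diagonal in the monomials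
    with eigenvalues m, becomes in the rotated monomials e_m a tridiagonal one,
      e_m |-> m cos phi e_m + (sin phi / 2) ((N + m) e_(m-1) + (N - m) e_(m+1))
    (coef_Xderiv_rot_mono). The k-th moment is therefore the (0, 0) entry of
    the k-th power of this operator divided by N. As only finitely many m near
    0 are involved, the divided operator tends to (sin phi / 2) times the sum
    of the two unit shifts. This limit is multiplication by sin phi cos theta
    on the functions cos (m theta), so that the k-th moment tends to
      1/pi int_0^pi (sin phi cos theta)^k dtheta
    (cvg_rot_moment), that is, to the k-th moment of the arcsine law on
    [- sin phi, sin phi].

    The masses are nonnegative and add up to 1, so Weierstrass' theorem
    (polynomial_approximation) extends the convergence from polynomials to
    continuous functions (cvg_sph_mean). The substitution t = c0 cos theta
    (integral_arcsine_weighted) gives the limit its stated form. *)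

(** * Rotated monomials and the Bombieri form *)

(** The inner product on polynomials of degree at most n that is invariant
    under SU(2), for which t^j has squared norm 1 / 'C(n, j). *)
Definition bombieri {R : fieldType} (n : nat) (p q : {poly R}) : R :=
  \sum_(j < n.+1) p`_j * q`_j / 'C(n, j)%:R.

(** The image of the monomial t^a of degree n = a + b under a rotation. *)
Definition rot_mono {R : nzRingType} (c d : R) (a b : nat) : {poly R} :=
  (c *: 'X - d%:P) ^+ a * (d *: 'X + c%:P) ^+ b.

Lemma bombieri_sumr {R : fieldType} (n : nat) (p : {poly R}) (I : Type)
    (r : seq I) (P : pred I) (F : I -> {poly R}) :
  bombieri n p (\sum_(i <- r | P i) F i) = \sum_(i <- r | P i) bombieri n p (F i).
Proof.
rewrite /bombieri exchange_big/=; apply: eq_bigr => j _.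
by rewrite coef_sum mulr_sumr mulr_suml.
Qed.

Lemma bombieriZr {R : fieldType} (n : nat) (k : R) (p q : {poly R}) :
  bombieri n p (k *: q) = k * bombieri n p q.
Proof.
rewrite /bombieri mulr_sumr; apply: eq_bigr => j _.
by rewrite coefZ mulrCA !mulrA.
Qed.

Lemma coef_linear_exp {R : comNzRingType} (u v : R) (n j : nat) :
  (j <= n)%N -> ((u *: 'X + v%:P) ^+ n)`_j = u ^+ j * v ^+ (n - j) *+ 'C(n, j).
Proof.
move=> jn; rewrite addrC exprDn coef_sum.
rewrite (bigD1 (inord j)) //= big1 ?addr0 => [|i ij].
  by rewrite inordK ?ltnS// exprZn -rmorphXn/= coefMn coefCM coefZ coefXn eqxx
    mulr1 mulrC.
rewrite exprZn -rmorphXn/= coefMn coefCM coefZ coefXn.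
case: eqP => [ji|_]; last by rewrite !mulr0 mul0rn.
by move: ij; rewrite -val_eqE/= inordK ?ltnS// ji eqxx.
Qed.

(** The n-th powers of linear forms are reproducing kernels of the form: the
    binomial coefficients of the power cancel those in the denominators. *)
Lemma bombieri_linear_exp {R : numFieldType} (n : nat) (p : {poly R}) (u v : R) :
  (size p <= n.+1)%N -> v != 0 ->
  bombieri n p ((u *: 'X + v%:P) ^+ n) = v ^+ n * p.[u / v].
Proof.
move=> sp v0; rewrite (horner_coef_wide _ sp) mulr_sumr.
apply: eq_bigr => -[j /= jn] _; rewrite coef_linear_exp//.
rewrite -mulr_natr mulrA mulfK; last by rewrite pnatr_eq0 -lt0n bin_gt0.
rewrite -{2}(subnK (_ : j <= n)%N)// exprD expr_div_n.
by field; rewrite expf_neq0.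
Qed.

Lemma size_linear_exp {R : nzRingType} (u v : R) (n : nat) :
  (size ((u *: 'X + v%:P) ^+ n) <= n.+1)%N.
Proof.
apply: leq_trans (size_poly_exp_leq _ _) _; rewrite ltnS.
suff : ((size (u *: 'X + v%:P)%R).-1 <= 1)%N.
  by rewrite -{2}(mul1n n) => le1; apply: leq_mul.
rewrite -subn1 leq_subLR (leq_trans (size_polyD _ _))// geq_max.
by rewrite (leq_trans (size_scale_leq _ _)) ?size_polyX// (leq_trans (size_polyC_leq1 _)).
Qed.

Lemma size_rot_mono {R : nzRingType} (c d : R) (a b : nat) :
  (size (rot_mono c d a b) <= (a + b).+1)%N.
Proof.
apply: leq_trans (size_polyMleq _ _) _; rewrite -polyCN.
have := leq_add (size_linear_exp c (- d) a) (size_linear_exp d c b).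
by rewrite -subn1 leq_subLR add1n addSn addnS.
Qed.

Lemma poly_ext_opp_nat {R : numDomainType} (p q : {poly R}) :
  (forall i : nat, p.[- i%:R] = q.[- i%:R]) -> p = q.
Proof.
move=> pq; apply/eqP; rewrite -subr_eq0; apply/eqP.
apply: (@roots_geq_poly_eq0 _ _ [seq - (i%:R : R) | i <- iota 0 (size (p - q))]).
- by apply/allP => _ /mapP[i _ ->]; rewrite /root hornerD hornerN pq subrr.
- rewrite map_inj_uniq ?iota_uniq// => i j /oppr_inj/eqP.
  by rewrite eqr_nat => /eqP.
- by rewrite size_map size_iota.
Qed.

(** Rotated monomials stay orthogonal, with the norms of the monomials. In the
    generating function over e of the left hand sides, the second arguments add
    up to the n-th power of a linear form, whose product with the first argument
    is an evaluation; the relation c^2 + d^2 = 1 reduces it to the monomial y^a. *)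
Lemma bombieri_rot_mono {R : numFieldType} (c d : R) (a b e : nat) :
  c ^+ 2 + d ^+ 2 = 1 -> 0 < c -> 0 < d -> (e <= a + b)%N ->
  'C(a + b, e)%:R
    * bombieri (a + b) (rot_mono c d a b) (rot_mono c d e (a + b - e))
  = (e == a)%:R.
Proof.
move=> cd1 c0 d0 en; set n := (a + b)%N.
set P := \poly_(i < n.+1) ('C(n, i)%:R *
  bombieri n (rot_mono c d a b) (rot_mono c d i (n - i))).
suff : P = 'X^a.
  by move=> /(congr1 (fun p : {poly R} => p`_e)); rewrite coef_poly ltnS en coefXn.
(* Nonpositive arguments keep the linear form away from the pole at c = y d. *)
apply: poly_ext_opp_nat => k; set y := - k%:R : R.
have v0 : c - y * d != 0.
  by rewrite /y mulNr opprK gt_eqF// ltr_wpDr// mulr_ge0// ltW.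
clearbody y.
have lin : ((d + y * c) *: 'X + (c - y * d)%:P) ^+ n
    = \sum_(i < n.+1) ('C(n, i)%:R * y ^+ i) *: rot_mono c d i (n - i).
  rewrite (_ : _ + _ = (d *: 'X + c%:P) + y *: (c *: 'X - d%:P)); last first.
    by rewrite -!mul_polyC !(polyCD, polyCN, polyCM); ring.
  rewrite exprDn; apply: eq_bigr => i _.
  rewrite /rot_mono exprZn -[in RHS]scalerA scaler_nat.
  by rewrite -!mul_polyC; ring.
have := @bombieri_linear_exp _ n (rot_mono c d a b) _ _ (size_rot_mono _ _ _ _) v0.
move=> /(_ (d + y * c)); rewrite lin bombieri_sumr.
rewrite hornerXn horner_poly => E.
transitivity (\sum_(i < n.+1) bombieri n (rot_mono c d a b)
    (('C(n, i)%:R * y ^+ i) *: rot_mono c d i (n - i))).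
  by apply: eq_bigr => i _; rewrite bombieriZr; ring.
rewrite E /rot_mono hornerM !horner_exp !(hornerD, hornerN, hornerC, hornerZ, hornerX).
rewrite exprD mulrACA -!exprMn.
have -> : (c - y * d) * (c * ((d + y * c) / (c - y * d)) - d) = y.
  by rewrite -[RHS]mulr1 -cd1; field.
have -> : (c - y * d) * (d * ((d + y * c) / (c - y * d)) + c) = 1.
  by rewrite -[RHS]cd1; field.
by rewrite expr1n mulr1.
Qed.

(** With A = c t - d and B = d t + c one has t = c A + d B, so that t d/dt maps
    A^a B^b to a combination of it and of its two neighbours. *)
Lemma coef_Xderiv_rot_mono {R : comNzRingType} (c d : R) (a b j : nat) :
  c ^+ 2 + d ^+ 2 = 1 ->
  j%:R * (rot_mono c d a.+1 b.+1)`_j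
  = (a.+1%:R * c ^+ 2 + b.+1%:R * d ^+ 2) * (rot_mono c d a.+1 b.+1)`_j
    + c * d * (a.+1%:R * (rot_mono c d a b.+2)`_j
               + b.+1%:R * (rot_mono c d a.+2 b)`_j).
Proof.
move=> cd1.
have XE : 'X * (rot_mono c d a.+1 b.+1)^`() =
    (a.+1%:R * c ^+ 2 + b.+1%:R * d ^+ 2) *: rot_mono c d a.+1 b.+1
    + (c * d) *: (a.+1%:R *: rot_mono c d a b.+2 + b.+1%:R *: rot_mono c d a.+2 b).
  rewrite /rot_mono; set A := c *: 'X - d%:P; set B := d *: 'X + c%:P.
  have cd1P : c%:P ^+ 2 + d%:P ^+ 2 = 1 :> {poly R}.
    by rewrite -!rmorphXn -rmorphD/= cd1.
  have XAB : 'X = c%:P * A + d%:P * B.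
    by rewrite /A /B -!mul_polyC -[LHS]mul1r -cd1P; ring.
  rewrite derivM !deriv_exp /A /B !poly.derivE -/A -/B !scaler_nat/=.
  rewrite [X in X * _]XAB -!mul_polyC.
  rewrite !(polyCD, polyCM, rmorphXn)/= !polyC_natr !exprS.
  ring.
have := congr1 (fun p : {poly R} => p`_j) XE.
rewrite coefXM !(coefD, coefZ) => <-; case: j => [|j]/=; first by rewrite mul0r.
by rewrite coef_deriv mulr_natl.
Qed.

(** * Moments of the weights of a rotated monomial *)

(** The matrix entry, between the rotated monomials of exponents (N, N) and
    (a, b), of the k-th power of the operator that multiplies t^j by (j - N)/N.
    The entry with (a, b) = (N, N) is a moment of the weights; the others are
    needed for the recursion on k. *)
Definition rot_moment {R : realType} (c d : R) (N k a b : nat) : R :=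
  \sum_(j < (2 * N).+1) 'C(2 * N, N)%:R / 'C(2 * N, j)%:R
    * (rot_mono c d N N)`_j * (rot_mono c d a b)`_j
    * ((j%:R - N%:R) / N%:R) ^+ k.

Lemma rot_moment0 {R : realType} (c d : R) (N a b : nat) :
  c ^+ 2 + d ^+ 2 = 1 -> 0 < c -> 0 < d -> (a + b = 2 * N)%N ->
  rot_moment c d N 0 a b = (a == N)%:R.
Proof.
move=> cd1 c0 d0 ab; have NN : (N + N = 2 * N)%N by rewrite addnn mul2n.
have aN : (a <= N + N)%N by rewrite NN -ab leq_addr.
have := bombieri_rot_mono c d N N a cd1 c0 d0 aN.
have -> : (N + N - a = b)%N by rewrite NN -ab addKn.
rewrite NN => E.
transitivity ('C(2 * N, N)%:R
    * bombieri (2 * N) (rot_mono c d N N) (rot_mono c d a b)).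
  rewrite /bombieri mulr_sumr; apply: eq_bigr => j _.
  by rewrite expr0 mulr1; ring.
case: eqP E => [-> //|_] /eqP; rewrite mulf_eq0 => /orP[|/eqP ->]; last first.
  by rewrite mulr0.
by rewrite pnatr_eq0 -leqn0 leqNgt bin_gt0 -NN aN.
Qed.

Lemma rot_momentS {R : realType} (c d : R) (N k a b : nat) :
  c ^+ 2 + d ^+ 2 = 1 ->
  rot_moment c d N k.+1 a.+1 b.+1
  = (a.+1%:R * c ^+ 2 + b.+1%:R * d ^+ 2 - N%:R) / N%:R
      * rot_moment c d N k a.+1 b.+1
    + c * d * (a.+1%:R / N%:R * rot_moment c d N k a b.+2
               + b.+1%:R / N%:R * rot_moment c d N k a.+2 b).
Proof.
move=> cd1; rewrite /rot_moment !mulr_sumr -big_split/= mulr_sumr -big_split/=.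
apply: eq_bigr => j _; have := coef_Xderiv_rot_mono c d a b j cd1.
rewrite [((_ - _) / _) ^+ k.+1]exprS.
set E0 := (rot_mono c d a.+1 b.+1)`_j; set v := _ / 'C(_, _)%:R.
set u := (_ / _) ^+ k; set w := (rot_mono c d N N)`_j => E.
transitivity (v * w * (j%:R * E0 - N%:R * E0) * u / N%:R); first by ring.
by rewrite E; ring.
Qed.

(** * Moments of the arcsine law *)

(** The limit of the matrix entries of the k-th power: the k-th power of
    multiplication by s cos t, tested against the function cos ((p - q) t).
    Naming the offset p - q by two natural numbers spares integer indices. *)
Definition arcsine_moment {R : realType} (s : R) (k p q : nat) : R :=
  pi^-1 * \int[@lebesgue_measure R]_(t in `[0, pi])
    ((s * cos t) ^+ k * cos ((p%:R - q%:R) * t)).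

Lemma continuous_trig_moment {R : realType} (s x : R) (k : nat) :
  continuous (fun t => (s * cos t) ^+ k * cos (x * t) : R).
Proof.
move=> t; apply: cvgM.
  elim: k => [|k ih]; first by rewrite expr0; exact: cvg_cst.
  under eq_fun do rewrite exprS.
  rewrite exprS; apply: cvgM => //; apply: cvgMr.
  exact: continuous_cos.
apply: (@continuous_comp _ _ _ (fun t => x * t) cos); last exact: continuous_cos.
exact: mulrl_continuous.
Qed.

Lemma integrable_continuous {R : realType} (a b : R) (f : R -> R) :
  continuous f ->
  (@lebesgue_measure R).-integrable `[a, b] (EFin \o f).
Proof.
move=> cf; apply: continuous_compact_integrable; first exact: segment_compact.
exact: continuous_subspaceT.
Qed.

(** This is the product formula 2 cos t cos (x t) = cos (x t - t) + cos (x t + t). *)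
Lemma arcsine_momentS {R : realType} (s : R) (k p q : nat) :
  arcsine_moment s k.+1 p q
  = s / 2 * (arcsine_moment s k p q.+1 + arcsine_moment s k p.+1 q).
Proof.
rewrite /arcsine_moment -mulrDr mulrCA -RintegralD//; first last.
- exact/integrable_continuous/continuous_trig_moment.
- exact/integrable_continuous/continuous_trig_moment.
congr (_ * _); rewrite -RintegralZl//; last first.
  apply: integrable_continuous => t.
  by apply: cvgD; exact: continuous_trig_moment.
apply: eq_Rintegral => t _.
rewrite exprS -mulrDr.
have -> : (p%:R - q.+1%:R) * t = (p%:R - q%:R) * t - t by ring.
have -> : (p.+1%:R - q%:R) * t = (p%:R - q%:R) * t + t by ring.
by rewrite cosB cosD; field.
Qed.

Lemma derivable_oo_LRcontinuousT {R : realType} (F f : R -> R) (a b : R) :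
  (forall t : R, is_derive t 1 F (f t)) -> derivable_oo_LRcontinuous F a b.
Proof.
move=> dF; have cF (t : R) : {for t, continuous F}.
  exact/differentiable_continuous/derivable1_diffP/(@ex_derive _ _ _ _ _ _ _ (dF t)).
split=> [t _||].
- exact: (@ex_derive _ _ _ _ _ _ _ (dF t)).
- exact/cvg_at_right_filter/cF.
- exact/cvg_at_left_filter/cF.
Qed.

Lemma sin_natpi {R : realType} (n : nat) : sin (n%:R * pi) = 0 :> R.
Proof.
elim: n => [|n ih]; first by rewrite mul0r sin0.
by rewrite -natr1 mulrDl mul1r sinDpi ih oppr0.
Qed.

Lemma arcsine_moment0 {R : realType} (s : R) (p q : nat) :
  arcsine_moment s 0 p q = (p == q)%:R.
Proof.
rewrite /arcsine_moment; case: eqP => [->|/eqP pq].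
  transitivity (pi^-1 * \int[@lebesgue_measure R]_(t in `[0, pi]) 1 : R).
    congr (_ * _); apply: eq_Rintegral => t _.
    by rewrite expr0 mul1r subrr mul0r cos0.
  rewrite Rintegral_cst//= lebesgue_measure_itv/= lte_fin pi_gt0/=.
  by rewrite subr0 mul1r mulVf// gt_eqF// pi_gt0.
have x0 : p%:R - q%:R != 0 :> R by rewrite subr_eq0 eqr_nat.
set x : R := p%:R - q%:R in x0 *.
have dF (t : R) : is_derive t 1 (fun t => sin (x * t) / x) (cos (x * t)).
  have -> : (fun t => sin (x * t) / x) = x^-1 \*: (sin \o (x \*: id)).
    by apply/funext => u /=; rewrite [RHS]mulrC.
  by apply: is_derive_eq; rewrite /GRing.scale/= mulr1 mulrCA mulVf ?mulr1.
rewrite /Rintegral (@continuous_FTC2 _ _ (fun t => sin (x * t) / x)).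
- rewrite mulr0 sin0 mul0r /= subr0 {1}/x mulrBl sinB !sin_natpi.
  by rewrite mul0r mulr0 subrr mul0r mulr0.
- exact: pi_gt0.
- exact/continuous_subspaceT/continuous_trig_moment.
- apply: derivable_oo_LRcontinuousT; exact: dF.
- by move=> t _; rewrite derive1E (@derive_val _ _ _ _ _ _ _ (dF t)) expr0 mul1r.
Qed.

(** * Convergence of the moments *)

Lemma cvg_div_natr {R : realType} (x : R) : x / N%:R @[N --> \oo] --> (0 : R).
Proof.
rewrite -(mulr0 x); apply: cvgM; first exact: cvg_cst.
rewrite -(cvg_shiftS (fun N => N%:R^-1 : R)); exact: cvg_harmonic.
Qed.

(** The diagonal term of the recursion is of size 1/N at a fixed distance from
    the middle exponent, while the ratios (N +- (p - q)) / N tend to 1; what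
    remains in the limit is the recursion satisfied by the arcsine moments. *)
Lemma cvg_rot_moment {R : realType} (c d : R) (k p q : nat) :
  c ^+ 2 + d ^+ 2 = 1 -> 0 < c -> 0 < d ->
  rot_moment c d N k (N + p - q) (N + q - p) @[N --> \oo]
    --> arcsine_moment (2 * c * d) k p q.
Proof.
move=> cd1 c0 d0; elim: k p q => [|k ih] p q.
  apply: cvg_near_cst; near=> N.
  have pqN : (p + q < N)%N by near: N; exact: nbhs_infty_gt.
  rewrite rot_moment0//; last by lia.
  by rewrite arcsine_moment0; congr (nat_of_bool _)%:R; lia.
rewrite arcsine_momentS.
pose x : R := p%:R - q%:R.
(* For p + q < N the exponents are positive and no subtraction truncates. *)
have step : \forall N \near \oo,
    (x * (c ^+ 2 - d ^+ 2)) / N%:R * rot_moment c d N k (N + p - q) (N + q - p)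
    + c * d * ((1 + x / N%:R) * rot_moment c d N k (N + p - q.+1) (N + q.+1 - p)
             + (1 - x / N%:R) * rot_moment c d N k (N + p.+1 - q) (N + q - p.+1))
    = rot_moment c d N k.+1 (N + p - q) (N + q - p).
  near=> N.
  have pqN : (p + q < N)%N by near: N; exact: nbhs_infty_gt.
  have N0 : N%:R != 0 :> R by rewrite pnatr_eq0; lia.
  have [a aE] : exists a, (N + p - q = a.+1)%N by exists (N + p - q).-1; lia.
  have [b bE] : exists b, (N + q - p = b.+1)%N by exists (N + q - p).-1; lia.
  have -> : (N + p - q.+1 = a)%N by lia.
  have -> : (N + q.+1 - p = b.+2)%N by lia.
  have -> : (N + p.+1 - q = a.+2)%N by lia.
  have -> : (N + q - p.+1 = b)%N by lia.
  rewrite aE bE rot_momentS//.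
  have -> : a.+1%:R = N%:R + x :> R.
    by rewrite -aE natrB ?natrD /x ?addrA//; lia.
  have -> : b.+1%:R = N%:R - x :> R.
    by rewrite -bE natrB ?natrD /x ?opprB ?addrA//; lia.
  congr (_ * _ + _ * (_ * _ + _ * _)); try by field.
  transitivity ((x * (c ^+ 2 - d ^+ 2) + N%:R * ((c ^+ 2 + d ^+ 2) - 1)) / N%:R).
    by rewrite cd1 subrr mulr0 addr0.
  by field.
apply: cvg_trans (near_eq_cvg step) _.
have -> : 2 * c * d / 2 * (arcsine_moment (2 * c * d) k p q.+1
      + arcsine_moment (2 * c * d) k p.+1 q)
    = 0 * arcsine_moment (2 * c * d) k p q
      + c * d * ((1 + 0) * arcsine_moment (2 * c * d) k p q.+1
                 + (1 - 0) * arcsine_moment (2 * c * d) k p.+1 q).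
  by field.
apply: cvgD; first by apply: cvgM => //; exact: cvg_div_natr.
apply: cvgM; first exact: cvg_cst.
apply: cvgD; apply: cvgM => //.
- by apply: cvgD; [exact: cvg_cst|exact: cvg_div_natr].
- by apply: cvgB; [exact: cvg_cst|exact: cvg_div_natr].
Unshelve. all: by end_near. Qed.

(** * Spherical harmonics on a latitude circle *)

(** The mass at (k - N) / N: the squared matrix coefficient of a rotation in an
    irreducible representation of dimension 2N + 1. *)
Definition order_weight {R : realType} (c d : R) (N k : nat) : R :=
  'C(2 * N, N)%:R / 'C(2 * N, k)%:R * (rot_mono c d N N)`_k ^+ 2.

(** The divided derivatives in Rodrigues' formula are the Taylor coefficients
    of (y^2 - 1)^N at x = cos phi. With s = sin phi,
      (x + s t)^2 - 1 = 2 s (c t - d) (d t + c),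
    so they are, up to powers of s, the coefficients of the rotated monomial. *)
Lemma rodrigues_coef {R : numFieldType} (c d : R) (N k : nat) :
  c ^+ 2 + d ^+ 2 = 1 -> (k <= 2 * N)%N ->
  (('X ^+ 2 - 1) ^+ N)^`N(k).[c ^+ 2 - d ^+ 2] * (2 * c * d) ^+ k
  = (2 * (2 * c * d)) ^+ N * (rot_mono c d N N)`_k.
Proof.
move=> cd1 k2N; set s := 2 * c * d; set x := c ^+ 2 - d ^+ 2.
set p : {poly R} := _ ^+ N.
have sp : (size p <= (2 * N).+1)%N.
  apply: leq_trans (size_poly_exp_leq _ _) _.
  have -> : 'X ^+ 2 - 1 = 'X^2 - 1%:P :> {poly R} by rewrite polyC1.
  by rewrite size_XnsubC.
have E : \poly_(i < (2 * N).+1) (p^`N(i).[x] * s ^+ i)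
    = (2 * s) ^+ N *: rot_mono c d N N.
  apply: poly_ext_opp_nat => i; set t := - _; clearbody t.
  rewrite horner_poly hornerZ /rot_mono -exprMn horner_exp -exprMn.
  transitivity (p.[x + s * t]).
    rewrite (nderiv_taylor_wide (mulrC _ _) sp).
    by apply: eq_bigr => j _; rewrite (exprMn _ s t) mulrA.
  rewrite /p horner_exp; congr (_ ^+ _).
  rewrite !(hornerD, hornerN, hornerC, hornerM, hornerZ, hornerX, hornerXn).
  transitivity ((x + s * t) ^+ 2 - (c ^+ 2 + d ^+ 2) ^+ 2).
    by rewrite cd1 expr1n expr2.
  by rewrite /x /s; ring.
have := congr1 (fun p : {poly R} => p`_k) E.
by rewrite coef_poly ltnS k2N coefZ.
Qed.

(** All powers of sin phi and of 2 cancel; in particular negative orders need no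
    separate treatment. *)
Lemma assoc_legendre_rot_mono {R : realType} (c d : R) (N k : nat) :
  c ^+ 2 + d ^+ 2 = 1 -> 0 < c -> 0 < d -> (k <= 2 * N)%N ->
  assoc_legendre N (k%:Z - N%:Z) (c ^+ 2 - d ^+ 2)
  = (-1) ^ (k%:Z - N%:Z) * (k`!%:R / N`!%:R) * (rot_mono c d N N)`_k.
Proof.
move=> cd1 c0 d0 k2N; rewrite /assoc_legendre.
rewrite [N%:Z + _]addrC subrK absz_nat.
have s0 : 0 < 2 * c * d by rewrite !mulr_gt0.
have -> : Num.sqrt (1 - (c ^+ 2 - d ^+ 2) ^+ 2) = 2 * c * d.
  transitivity (Num.sqrt ((c ^+ 2 + d ^+ 2) ^+ 2 - (c ^+ 2 - d ^+ 2) ^+ 2)).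
    by rewrite cd1 expr1n.
  by rewrite -[RHS]gtr0_norm// -sqrtr_sqr; congr Num.sqrt; ring.
have -> : (2 * c * d) ^ (k%:Z - N%:Z) = (2 * c * d) ^+ k / (2 * c * d) ^+ N.
  by rewrite expfzDr ?gt_eqF// exprnN.
rewrite nderivn_def hornerMn.
have := rodrigues_coef c d N k cd1 k2N.
move: (_.[_]) => P E.
have N0 : N`!%:R != 0 :> R by rewrite pnatr_eq0 -lt0n fact_gt0.
have -> : (rot_mono c d N N)`_k = P * (2 * c * d) ^+ k / (2 * (2 * c * d)) ^+ N.
  by rewrite E mulrC mulKf// expf_neq0// mulf_neq0// ?pnatr_eq0// gt_eqF.
move: s0; set s := 2 * c * d => s0; rewrite -[P *+ _]mulr_natr [(2 * s) ^+ N]exprMn.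
have s1 : s ^+ N != 0 by rewrite expf_neq0 ?gt_eqF.
have s2 : 2 ^+ N != 0 :> R by rewrite expf_neq0// pnatr_eq0.
by field; rewrite N0 s1 s2.
Qed.

(** The factorials combine to k! (2N - k)! / (N! N!), a quotient of binomial
    coefficients. *)
Lemma assoc_legendre_order_weight {R : realType} (c d : R) (N k : nat) :
  c ^+ 2 + d ^+ 2 = 1 -> 0 < c -> 0 < d -> (k <= 2 * N)%N ->
  (absz (N%:Z - (k%:Z - N%:Z))%R)`!%:R / (absz (N%:Z + (k%:Z - N%:Z))%R)`!%:R
   * assoc_legendre N (k%:Z - N%:Z) (c ^+ 2 - d ^+ 2) ^+ 2
  = 'C(2 * N, N)%:R / 'C(2 * N, k)%:R * (rot_mono c d N N)`_k ^+ 2.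
Proof.
move=> cd1 c0 d0 k2N.
rewrite assoc_legendre_rot_mono// [N%:Z + (k%:Z - _)]addrC subrK absz_nat.
rewrite opprB addrA -PoszD addnn -mul2n (subzn k2N) absz_nat.
rewrite !exprMn.
have -> : ((-1 : R) ^ (k%:Z - N%:Z)) ^+ 2 = 1.
  by rewrite exprnP exprzAC -exprnP sqrrN expr1n exp1rz.
have f0 n : n`!%:R != 0 :> R by rewrite pnatr_eq0 -lt0n fact_gt0.
have := bin_fact k2N => /(congr1 (fun n => n%:R : R)).
have NN : (N <= 2 * N)%N by rewrite leq_pmull.
have := bin_fact NN => /(congr1 (fun n => n%:R : R)).
rewrite {2}mul2n -addnn addnK !natrM => <- E2.
have -> : 'C(2 * N, k)%:R =
    'C(2 * N, N)%:R * (N`!%:R * N`!%:R) / (k`!%:R * (2 * N - k)`!%:R) :> R.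
  by rewrite -E2 mulfK// mulf_neq0.
have C0 : 'C(2 * N, N)%:R != 0 :> R by rewrite pnatr_eq0 -lt0n bin_gt0.
by field; rewrite C0 !f0.
Qed.

Lemma latitude_speedE {R : realType} (phi theta : R) : 0 < sin phi ->
  latitude_speed phi theta = sin phi.
Proof.
move=> s0; rewrite /latitude_speed !big_ord_recl big_ord0 /sphere_pt/=.
have h (f : R -> R) (l : R) : is_derive theta 1 f l -> derive1 f theta = l.
  by move=> h; rewrite derive1E; apply: derive_val.
have -> : derive1 (fun s => sin phi * cos s) theta = sin phi * - sin theta.
  by apply: h; apply: is_derive_eq; rewrite /GRing.scale/=; ring.
have -> : derive1 (fun s => sin phi * sin s) theta = sin phi * cos theta.
  by apply: h; apply: is_derive_eq; rewrite /GRing.scale/=; ring.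
rewrite derive1_cst.
rewrite -[RHS]gtr0_norm// -sqrtr_sqr; congr Num.sqrt.
rewrite -[RHS]mulr1 -(cos2Dsin2 theta); ring.
Qed.

Lemma normc_expi {R : realType} (a t : R) :
  ComplexField.Normc.normc (a%:C%C * expi t) ^+ 2 = a ^+ 2.
Proof.
rewrite /expi /=.
rewrite sqr_sqrtr ?addr_ge0 ?sqr_ge0// !mul0r subr0 addr0.
rewrite -[RHS]mulr1 -(cos2Dsin2 t); ring.
Qed.

Lemma latitude_L2norm_sph_harm {R : realType} (phi : R) (N : nat) (m : int) :
  0 < sin phi ->
  latitude_L2norm phi (sph_harm N m) ^+ 2
  = 2 * pi * sin phi * ((2 * N%:R + 1) / (4 * pi)
      * ((absz (N%:Z - m)%R)`!%:R / (absz (N%:Z + m)%R)`!%:R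
         * assoc_legendre N m (cos phi) ^+ 2)).
Proof.
move=> s0; set C := _ / (4 * pi) * _.
have A0 : 0 <= (2 * N%:R + 1) / (4 * pi) :> R.
  by rewrite divr_ge0 ?addr_ge0 ?mulr_ge0 ?pi_ge0.
have F0 : 0 <= (absz (N%:Z - m)%R)`!%:R / (absz (N%:Z + m)%R)`!%:R :> R.
  by rewrite divr_ge0.
rewrite /latitude_L2norm sqr_sqrtr; last first.
  apply: Rintegral_ge0 => theta _.
  by rewrite mulr_ge0 ?sqr_ge0// latitude_speedE// ltW.
transitivity (\int[@lebesgue_measure R]_(theta in `]0%R, (2 * pi)%R[) (C * sin phi)).
  apply: eq_Rintegral => theta _; rewrite latitude_speedE// /sph_harm normc_expi.
  rewrite exprMn sqr_sqrtr; first by rewrite /C !mulrA.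
  by rewrite -[X in 0 <= X]mulrA mulr_ge0.
rewrite Rintegral_cst//= lebesgue_measure_itv/= lte_fin mulr_gt0 ?pi_gt0//=.
by rewrite subr0; ring.
Qed.

Lemma latitude_L2norm_order_weight {R : realType} (c d phi : R) (N k : nat) :
  c ^+ 2 + d ^+ 2 = 1 -> 0 < c -> 0 < d ->
  cos phi = c ^+ 2 - d ^+ 2 -> 0 < sin phi -> (k <= 2 * N)%N ->
  (sin phi * (N%:R + 2^-1))^-1
    * latitude_L2norm phi (sph_harm N (k%:Z - N%:Z)) ^+ 2
  = order_weight c d N k.
Proof.
move=> cd1 c0 d0 cosE s0 kN; rewrite latitude_L2norm_sph_harm// cosE.
rewrite assoc_legendre_order_weight//.
rewrite -/(order_weight c d N k); move: (order_weight _ _ _ _) => w.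
have pi0 : pi != 0 :> R by rewrite gt_eqF// pi_gt0.
have N0 : 2 * N%:R + 1 != 0 :> R by rewrite gt_eqF// ltr_wpDl// mulr_ge0.
have sn0 : sin phi != 0 by rewrite gt_eqF.
move: (pi : R) (sin phi) pi0 sn0 => p s pi0 sn0.
by field; rewrite pi0 mulrC N0 sn0.
Qed.

Lemma ge0_integral_mu {R : realType} (c0 : R) (c0_gt0 : 0 < c0) (phi : R)
    (N : nat) (h : R -> R) :
  (0 < N)%N -> measurable_fun (`[(-1)%R, 1%R] : set (measurableTypeR R)) h ->
  (forall t, 0 <= h t) ->
  (\int[mu c0_gt0 phi N]_(t in `[(-1)%R, 1%R]) (h t)%:E
  = (\sum_(k < 2 * N + 1) (c0 * (N%:R + 2^-1))^-1
      * latitude_L2norm phi (sph_harm N (k%:Z - N%:Z)) ^+ 2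
      * h ((k%:Z - N%:Z)%:~R / N%:R))%R%:E)%E.
Proof.
move=> N0 mh h0.
have mh' : measurable_fun (`[(-1)%R, 1%R] : set (measurableTypeR R))
    (EFin \o h) by exact/measurable_EFinP.
rewrite /mu ge0_integral_mscale//; last by move=> x _; rewrite lee_fin.
rewrite ge0_integral_measure_sum//; last by move=> x _; rewrite lee_fin.
rewrite -sumEFin ge0_sume_distrr; last first.
  by move=> k _; apply: integral_ge0 => x _; rewrite lee_fin.
apply: eq_bigr => -[k /= kN] _.
rewrite ge0_integral_mscale//=; last by move=> x _; rewrite lee_fin.
rewrite integral_dirac// diracE mem_set ?mul1e ?EFinM ?muleA//=.
rewrite in_itv/= rmorphB/= -!pmulrn.
have N0' : 0 < N%:R :> R by rewrite ltr0n.
rewrite ler_pdivlMr// ler_pdivrMr// mulN1r mul1r lerBlDr -natrD addnn -mul2n.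
by rewrite ler_nat addn1 ltnS in kN *; rewrite kN andbT lerBrDr addNr.
Qed.

(** The integrals of the positive and negative parts are finite sums, so that
    they can be subtracted. *)
Lemma integral_mu {R : realType} (c0 : R) (c0_gt0 : 0 < c0) (phi : R)
    (N : nat) (h : R -> R) :
  (0 < N)%N -> measurable_fun (`[(-1)%R, 1%R] : set (measurableTypeR R)) h ->
  (\int[mu c0_gt0 phi N]_(t in `[(-1)%R, 1%R]) (h t)%:E
  = (\sum_(k < 2 * N + 1) (c0 * (N%:R + 2^-1))^-1
      * latitude_L2norm phi (sph_harm N (k%:Z - N%:Z)) ^+ 2
      * h ((k%:Z - N%:Z)%:~R / N%:R))%R%:E)%E.
Proof.
move=> N0 mh; rewrite integralE [X in integral _ _ X]funerpos.
rewrite [X in (_ - integral _ _ X)%E]funerneg.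
rewrite ge0_integral_mu; [|by []|exact: measurable_funrpos|exact: funrpos_ge0].
rewrite ge0_integral_mu; [|by []|exact: measurable_funrneg|exact: funrneg_ge0].
rewrite -EFinB -sumrB; congr EFin; apply: eq_bigr => k _.
by rewrite -mulrBr -[in RHS](funrposBneg h).
Qed.

(** * Uniform approximation by polynomials *)

(** The expectation of h at a binomial variable, conditioned on the first of n
    trials of success probability 'X. This recursive form makes all bounds on
    Bernstein polynomials inductions on n, free of binomial coefficients. *)
Fixpoint bernstein {R : nzRingType} (n : nat) (h : nat -> R) : {poly R} :=
  if n is m.+1 then
    'X * bernstein m (fun k => h k.+1) + (1 - 'X) * bernstein m h
  else (h 0%N)%:P.

(** Positivity of the Bernstein operators together with the variance n u (1 - u)
    of the binomial law; the shift a is there for the induction, where it absorbs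
    the outcome of the first trial. *)
Lemma bernstein_dist_le {R : realFieldType} (n : nat) (h : nat -> R)
    (u v a e K : R) :
  0 <= u <= 1 ->
  (forall k, (k <= n)%N -> `|h k - v| <= e + K * (k%:R + a - n%:R * u) ^+ 2) ->
  `|(bernstein n h).[u] - v| <= e + K * (a ^+ 2 + n%:R * (u * (1 - u))).
Proof.
move=> /andP[u0 u1]; elim: n h a => [|n ih] h a hv.
  rewrite /= hornerC (le_trans (hv 0%N (leqnn _)))//.
  by rewrite !mul0r !add0r subr0 addr0.
rewrite [bernstein _ _]/= !(hornerD, hornerM, hornerN, hornerC, hornerX).
set P := (bernstein n (fun k => h k.+1)).[u]; set Q := (bernstein n h).[u].
have hP : `|P - v| <= e + K * ((a + 1 - u) ^+ 2 + n%:R * (u * (1 - u))).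
  apply: ih => k kn; apply: le_trans (hv k.+1 kn) _.
  rewrite -!natr1 le_eqVlt; apply/orP; left; apply/eqP; ring.
have hQ : `|Q - v| <= e + K * ((a - u) ^+ 2 + n%:R * (u * (1 - u))).
  apply: ih => k kn; apply: le_trans (hv k (leqW kn)) _.
  rewrite -!natr1 le_eqVlt; apply/orP; left; apply/eqP; ring.
have -> : u * P + (1 - u) * Q - v = u * (P - v) + (1 - u) * (Q - v) by ring.
apply: le_trans (ler_normD _ _) _; rewrite !normrM (ger0_norm u0).
rewrite (@ger0_norm _ (1 - u)) ?subr_ge0//.
have u1' : 0 <= 1 - u by rewrite subr_ge0.
apply: le_trans (lerD (ler_wpM2l u0 hP) (ler_wpM2l u1' hQ)) _.
rewrite -!natr1 le_eqVlt; apply/orP; left; apply/eqP; ring.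
Qed.

(** The radius is obtained by compactness from the pointwise ones, through
    near-coverings; y ranges over all reals, not only over A. *)
Lemma compact_uniform_continuous {R : realType} (A : set R) (f : R -> R) (e : R) :
  compact A -> continuous f -> 0 < e ->
  exists2 r : R, 0 < r & forall x y, A x -> `|x - y| < r -> `|f x - f y| < e.
Proof.
move=> /compact_near_coveringP cA cf e0.
pose P (r x : R) := forall y, `|x - y| < r -> `|f x - f y| < e.
have near_P : \forall r \near (0 : R)^'+, A `<=` P r.
  apply: cA => x _.
  have /cvgrPdist_lt/(_ (e / 2)) : f y @[y --> x] --> f x by exact: cf.
  rewrite divr_gt0// => /(_ isT)/nbhs_ballP[r /= r0 fr].
  exists (ball x (r / 2), [set s | s < r / 2]) => /=.
    split; first exact/nbhsx_ballx/divr_gt0.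
    by apply: nbhs_right_lt; rewrite divr_gt0.
  move=> [y s] /= [xy sr] z yz.
  have -> : f y - f z = (f x - f z) - (f x - f y) by ring.
  apply: le_lt_trans (ler_normB _ _) _; rewrite [ltRHS]splitr.
  apply: ltrD; apply: fr; rewrite /ball/= in xy *; last first.
    by apply: lt_trans xy _; rewrite ltr_pdivrMr// ltr_pMr// ltr1n.
  have -> : x - z = (x - y) + (y - z) by ring.
  apply: le_lt_trans (ler_normD _ _) _; rewrite [ltRHS]splitr.
  by apply: ltrD => //; apply: lt_trans yz sr.
near (0 : R)^'+ => r; exists r; first by [].
move=> x y Ax; have : A `<=` P r by near: r.
by move=> /(_ x Ax y).
Unshelve. all: by end_near. Qed.

(** A continuous function f on [-1, 1] has a modulus of the form
    |f x - f y| <= e / 2 + K (x - y)^2: uniform continuity bounds the left hand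
    side for close points, boundedness of f for the others. Taking y as the
    argument and x as a node, the variance bound makes the error of the
    Bernstein polynomial at most e / 2 + K / n. *)
Lemma polynomial_approximation {R : realType} (f : R -> R) (e : R) :
  continuous f -> 0 < e ->
  exists p : {poly R}, forall t, -1 <= t <= 1 -> `|f t - p.[t]| <= e.
Proof.
move=> cf e0; set A := `[(-1 : R), 1]%classic.
have e20 : 0 < e / 2 by rewrite divr_gt0.
have [r r0 fr] := compact_uniform_continuous A f (e / 2) (@segment_compact _ _ _) cf e20.
have [M M0 fM] : exists2 M : R, 0 <= M & forall t, A t -> `|f t| <= M.
  have /compact_bounded[M [_ fM]] : compact (f @` A).
    apply: continuous_compact; last exact: segment_compact.
    exact: continuous_subspaceT.
  exists (Num.max (M + 1) 0); first by rewrite le_max lexx orbT.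
  by move=> t At; apply: fM; [rewrite lt_max ltrDl ltr01|exists t].
(* This K makes K (x - y)^2 at least 2 M as soon as |x - y| >= r. *)
pose K := 2 * M / r ^+ 2.
have K0 : 0 <= K by apply: divr_ge0; [exact: mulr_ge0|exact: sqr_ge0].
have fK x y : A x -> A y -> `|f x - f y| <= e / 2 + K * (x - y) ^+ 2.
  move=> Ax Ay; have [xyr|rxy] := ltP `|x - y| r.
    by apply: le_trans (ltW (fr x y Ax xyr)) _; rewrite lerDl mulr_ge0// sqr_ge0.
  apply: le_trans (ler_normB _ _) _.
  apply: le_trans (lerD (fM x Ax) (fM y Ay)) _.
  have -> : M + M = 0 + 2 * M by ring.
  apply: lerD; first exact: ltW.
  rewrite /K mulrAC ler_pdivlMr ?exprn_gt0// ler_wpM2l ?mulr_ge0//.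
  rewrite -[leRHS]real_normK ?num_real//.
  by apply: lerXn2r => //; rewrite nnegrE ltW.
have [n n0 nK] : exists2 n : nat, (0 < n)%N & K / n%:R <= e / 2.
  near \oo => n; exists n; first by near: n; exact: nbhs_infty_gt.
  have n0 : 0 < n%:R :> R by rewrite ltr0n; near: n; exact: nbhs_infty_gt.
  rewrite ler_pdivrMr// mulrC -ler_pdivrMr//; near: n; exact: nbhs_infty_ger.
have n0' : 0 < n%:R :> R by rewrite ltr0n.
pose node (k : nat) : R := k%:R / n%:R * 2 - 1.
exists (bernstein n (f \o node) \Po (2^-1 *: 'X + 2^-1%:P)) => t t1.
have At : A t by rewrite /A/= in_itv.
rewrite horner_comp !(hornerD, hornerZ, hornerC, hornerX) distrC.
set u := 2^-1 * t + 2^-1.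
have u01 : 0 <= u <= 1 by move: t1; rewrite /u => /andP[? ?]; apply/andP; split; lra.
have := @bernstein_dist_le _ n (f \o node) u (f t) 0 (e / 2) (4 * K / n%:R ^+ 2) u01.
have hyp k : (k <= n)%N ->
    `|(f \o node) k - f t| <= e / 2 + 4 * K / n%:R ^+ 2 * (k%:R + 0 - n%:R * u) ^+ 2.
  move=> kn; have Ak : A (node k).
    rewrite /A /node/= in_itv/=.
    have k0 : 0 <= k%:R / n%:R :> R by rewrite divr_ge0.
    have k1 : k%:R / n%:R <= 1 :> R by rewrite ler_pdivrMr// mul1r ler_nat.
    by apply/andP; split; lra.
  apply: le_trans (fK _ _ Ak At) _; rewrite lerD2l le_eqVlt; apply/orP; left.
  by apply/eqP; rewrite /node /u; field; rewrite gt_eqF.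
move=> /(_ hyp) /le_trans; apply.
rewrite [leRHS]splitr lerD2l; apply: le_trans nK.
have -> : 4 * K / n%:R ^+ 2 * (0 ^+ 2 + n%:R * (u * (1 - u)))
    = K / n%:R * (4 * (u * (1 - u))) by field; rewrite gt_eqF.
rewrite -[leRHS]mulr1; apply: ler_wpM2l.
  by apply: divr_ge0 => //; exact: ltW.
have := sqr_ge0 (2 * u - 1); nra.
Unshelve. all: by end_near. Qed.

(** * Weak convergence of the weights *)

Definition sph_mean {R : realType} (c d : R) (N : nat) (f : R -> R) : R :=
  \sum_(k < (2 * N).+1) order_weight c d N k * f ((k%:R - N%:R) / N%:R).

(** The arcsine law on [-s, s] as the image of the uniform law on [0, pi] under
    s cos; this form has no singularity. *)
Definition arcsine_mean {R : realType} (s : R) (f : R -> R) : R :=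
  pi^-1 * \int[@lebesgue_measure R]_(t in `[0, pi]) f (s * cos t).

Lemma continuous_comp_scale_cos {R : realType} (s : R) (f : R -> R) :
  continuous f -> continuous (fun t => f (s * cos t)).
Proof.
move=> cf t; apply: (@continuous_comp _ _ _ (fun t => s * cos t) f); last exact: cf.
by apply: cvgMr; exact: continuous_cos.
Qed.

Lemma arcsine_meanD {R : realType} (s : R) (f g : R -> R) :
  continuous f -> continuous g ->
  arcsine_mean s (fun t => f t + g t) = arcsine_mean s f + arcsine_mean s g.
Proof.
move=> cf cg; rewrite /arcsine_mean -mulrDr RintegralD//.
- exact/integrable_continuous/continuous_comp_scale_cos.
- exact/integrable_continuous/continuous_comp_scale_cos.
Qed.

Lemma arcsine_meanZ {R : realType} (s a : R) (f : R -> R) :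
  continuous f -> arcsine_mean s (fun t => a * f t) = a * arcsine_mean s f.
Proof.
move=> cf; rewrite /arcsine_mean mulrCA RintegralZl//.
exact/integrable_continuous/continuous_comp_scale_cos.
Qed.

Lemma arcsine_meanB {R : realType} (s : R) (f g : R -> R) :
  continuous f -> continuous g ->
  arcsine_mean s (fun t => f t - g t) = arcsine_mean s f - arcsine_mean s g.
Proof.
move=> cf cg; rewrite /arcsine_mean -mulrBr RintegralB//.
- exact/integrable_continuous/continuous_comp_scale_cos.
- exact/integrable_continuous/continuous_comp_scale_cos.
Qed.

Lemma arcsine_mean_norm_le {R : realType} (s e : R) (f : R -> R) :
  0 <= s <= 1 -> continuous f ->
  (forall t, -1 <= t <= 1 -> `|f t| <= e) -> `|arcsine_mean s f| <= e.
Proof.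
move=> /andP[s0 s1] cf fe; have p0 := pi_gt0 R.
rewrite /arcsine_mean normrM gtr0_norm ?invr_gt0// ler_pdivrMl//.
have int_f := integrable_continuous 0 pi _ (continuous_comp_scale_cos s f cf).
apply: le_trans (le_normr_Rintegral _ int_f) _ => //.
have <- : \int[@lebesgue_measure R]_(t in `[0, pi]) e = pi * e.
  by rewrite Rintegral_cst//= lebesgue_measure_itv/= lte_fin p0/= subr0 mulrC.
apply: le_Rintegral => //.
- apply: integrable_continuous; apply: (continuous_comp_scale_cos s (fun t => `|f t|)).
  by move=> t; apply: cvg_norm; exact: cf.
- by apply: integrable_continuous => t; exact: cvg_cst.
- move=> t _; apply: fe.
  have := cos_le1 t; have := cos_geN1 t; nra.
Qed.

Lemma order_weight_ge0 {R : realType} (c d : R) (N k : nat) : 0 <= order_weight c d N k.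
Proof. by rewrite mulr_ge0 ?sqr_ge0// divr_ge0. Qed.

Lemma sum_order_weight {R : realType} (c d : R) (N : nat) :
  c ^+ 2 + d ^+ 2 = 1 -> 0 < c -> 0 < d ->
  \sum_(k < (2 * N).+1) order_weight c d N k = 1.
Proof.
move=> cd1 c0 d0; transitivity (rot_moment c d N 0 N N).
  by apply: eq_bigr => k _; rewrite expr0 mulr1 /order_weight expr2 mulrA.
by rewrite rot_moment0 ?eqxx// addnn mul2n.
Qed.

Lemma sph_meanB {R : realType} (c d : R) (N : nat) (f g : R -> R) :
  sph_mean c d N (fun t => f t - g t) = sph_mean c d N f - sph_mean c d N g.
Proof. by rewrite /sph_mean -sumrB; apply: eq_bigr => k _; rewrite mulrBr. Qed.

Lemma sph_mean_norm_le {R : realType} (c d e : R) (N : nat) (f : R -> R) :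
  c ^+ 2 + d ^+ 2 = 1 -> 0 < c -> 0 < d -> (0 < N)%N ->
  (forall t, -1 <= t <= 1 -> `|f t| <= e) -> `|sph_mean c d N f| <= e.
Proof.
move=> cd1 c0 d0 N0 fe; apply: le_trans (ler_norm_sum _ _ _) _.
apply: (@le_trans _ _ (\sum_(k < (2 * N).+1) order_weight c d N k * e)); last first.
  by rewrite -mulr_suml sum_order_weight// mul1r.
apply: ler_sum => -[k kN] _; rewrite normrM ger0_norm ?order_weight_ge0//.
rewrite ler_wpM2l ?order_weight_ge0// fe//=.
have N0' : 0 < N%:R :> R by rewrite ltr0n.
rewrite ler_pdivlMr// ler_pdivrMr// mulN1r mul1r lerBlDr -natrD addnn -mul2n.
by rewrite ler_nat -ltnS kN andbT lerBrDr addNr.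
Qed.

Lemma cvg_sph_mean_poly {R : realType} (c d : R) (p : {poly R}) :
  c ^+ 2 + d ^+ 2 = 1 -> 0 < c -> 0 < d ->
  sph_mean c d N (horner p) @[N --> \oo] --> arcsine_mean (2 * c * d) (horner p).
Proof.
move=> cd1 c0 d0.
have cp (q : {poly R}) : continuous (fun t : R => q.[t] : R).
  by move=> t; exact: (@continuous_horner R q t).
pose P (q : {poly R}) := sph_mean c d N (horner q) @[N --> \oo]
  --> arcsine_mean (2 * c * d) (horner q).
rewrite -/(P p) -[p]coefK poly_def; apply: (big_rec P) => [|i q _ ih]; rewrite /P.
  have -> : horner 0 = (fun t : R => 0 * (horner 0 t)).
    by apply/funext => t; rewrite horner0 mul0r.
  rewrite arcsine_meanZ// mul0r; apply: cvg_near_cst; near=> N.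
  by rewrite /sph_mean big1// => k _; rewrite mul0r mulr0.
have -> : horner (p`_i *: 'X^i + q) = fun t => p`_i * t ^+ i + q.[t].
  by apply/funext => t; rewrite !hornerE.
have ci : continuous (fun t : R => t ^+ i) by exact: exprn_continuous.
rewrite arcsine_meanD ?arcsine_meanZ//; last first.
  by move=> t; apply: cvgMr; exact: ci.
have -> : sph_mean c d ^~ (fun t => p`_i * t ^+ i + q.[t])
    = fun N => p`_i * rot_moment c d N i (N + 0 - 0) (N + 0 - 0)
        + sph_mean c d N (horner q).
  apply/funext => N; rewrite /sph_mean /rot_moment addn0 subn0 mulr_sumr.
  rewrite -big_split/=; apply: eq_bigr => k _.
  by rewrite /order_weight expr2; ring.
apply: cvgD => //; apply: cvgMr.
have -> : arcsine_mean (2 * c * d) (fun t => t ^+ i)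
    = arcsine_moment (2 * c * d) i 0 0.
  congr (_ * _); apply: eq_Rintegral => t _.
  by rewrite subrr mul0r cos0 mulr1.
exact: cvg_rot_moment.
Unshelve. all: by end_near. Qed.

(** A three-epsilon argument: both means have norm at most 1 for the supremum
    norm on [-1, 1]. *)
Lemma cvg_sph_mean {R : realType} (c d : R) (f : R -> R) :
  c ^+ 2 + d ^+ 2 = 1 -> 0 < c -> 0 < d -> continuous f ->
  sph_mean c d N f @[N --> \oo] --> arcsine_mean (2 * c * d) f.
Proof.
move=> cd1 c0 d0 cf; set s := 2 * c * d.
have s01 : 0 <= s <= 1.
  apply/andP; split; first by rewrite /s !mulr_ge0 ?ltW.
  by have := sqr_ge0 (c - d); rewrite /s; nra.
apply/cvgrPdist_le => e e0; have e30 : 0 < e / 3 by rewrite divr_gt0.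
have [p fp] := polynomial_approximation f (e / 3) cf e30.
have cp : continuous (fun t : R => p.[t] : R).
  by move=> t; exact: (@continuous_horner R p t).
have cfp : continuous (fun t => f t - p.[t]) by move=> t; exact: (cvgB (cf t) (cp t)).
have := cvg_sph_mean_poly c d p cd1 c0 d0; rewrite -/s => /cvgrPdist_le/(_ _ e30) near_p.
near=> N.
have N0 : (0 < N)%N by near: N; exact: nbhs_infty_gt.
have -> : arcsine_mean s f - sph_mean c d N f
  = arcsine_mean s (fun t => f t - p.[t])
    + (arcsine_mean s (horner p) - sph_mean c d N (horner p))
    - sph_mean c d N (fun t => f t - p.[t]).
  by rewrite sph_meanB arcsine_meanB//; ring.
have h1 : `|arcsine_mean s (fun t => f t - p.[t])| <= e / 3.
  exact: arcsine_mean_norm_le.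
have h2 : `|sph_mean c d N (fun t => f t - p.[t])| <= e / 3.
  exact: sph_mean_norm_le.
have h3 : `|arcsine_mean s (horner p) - sph_mean c d N (horner p)| <= e / 3.
  by near: N.
apply: le_trans (ler_normB _ _) _; apply: le_trans (lerD (ler_normD _ _) (lexx _)) _.
lra.
Unshelve. all: by end_near. Qed.

(** * The change of variables t = s cos(theta) *)

(** At t = s and t = - s this is 0, because the inverse of 0 is 0; the real power
    of exponent - 1/2 has the same values there. *)
Definition arcsine_weighted {R : realType} (s : R) (g : R -> R) (t : R) : R :=
  g t / Num.sqrt (1 - (t / s) ^+ 2).

Lemma arcsine_weightedE {R : realType} (s : R) (g : R -> R) (t : R) :
  0 < s -> - s <= t <= s ->
  g t * (1 - (t / s) ^+ 2) `^ (- 2^-1) = arcsine_weighted s g t.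
Proof.
move=> s0 /andP[ts1 ts2]; rewrite powRN powR12_sqrt// subr_ge0.
rewrite expr2 -[leRHS]mulr1 -[leRHS]expr2 -expr2.
have : -1 <= t / s <= 1 by rewrite ler_pdivlMr// ler_pdivrMr// mulN1r mul1r ts1.
by move=> /andP[? ?]; nra.
Qed.

Lemma arcsine_weighted_continuous {R : realType} (s : R) (g : R -> R) (t : R) :
  0 < s -> continuous g -> - s < t < s -> {for t, continuous (arcsine_weighted s g)}.
Proof.
move=> s0 cg /andP[ts1 ts2]; apply: cvgM; first exact: cg.
have : -1 < t / s < 1 by rewrite ltr_pdivlMr// ltr_pdivrMr// mulN1r mul1r ts1.
move=> /andP[? ?].
have pos : 0 < 1 - (t / s) ^+ 2 by nra.
apply: cvgV; first by rewrite gt_eqF// sqrtr_gt0.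
have csq : 1 - (x / s) ^+ 2 @[x --> t] --> 1 - (t / s) ^+ 2.
  apply: cvgB; first exact: cvg_cst.
  rewrite expr2; under eq_fun do rewrite expr2.
  by apply: cvgM; apply: cvgMl; exact: cvg_id.
exact: (cvg_comp _ _ csq (@sqrt_continuous R _)).
Qed.

(** Away from the end points, where the density blows up, both sides of the
    substitution are continuous. *)
Lemma arcsine_substitution_truncated {R : realType} (s a : R) (g : R -> R) :
  0 < s -> continuous g -> 0 < a -> a <= pi / 2 ->
  (\int[@lebesgue_measure R]_(t in `[(- (s * cos a))%R, (s * cos a)%R])
      (arcsine_weighted s g t)%:E
   = \int[@lebesgue_measure R]_(t in `[a, (pi - a)%R]) (s * g (s * cos t))%:E)%E.
Proof.
move=> s0 cg a0 api; have p0 := pi_gt0 R.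
pose F (t : R) := s * cos t.
have dF (t : R) : is_derive t 1 F (- (s * sin t)).
  have -> : F = s \*: cos by [].
  by apply: is_derive_eq; rewrite /GRing.scale/= mulrN.
have dFE : derive1 F = (fun t => - (s * sin t)).
  by apply/funext => t; rewrite derive1E; exact: (@derive_val _ _ _ _ _ _ _ (dF t)).
have cdF : continuous (derive1 F).
  by move=> t; rewrite dFE; apply: cvgN; apply: cvgMr; exact: continuous_sin.
have Fb : F (pi - a) = - (s * cos a).
  by rewrite /F addrC cosDpi cosN mulrN.
have ab : a <= pi - a by lra.
have ca : cos a < 1.
  rewrite -(@cos0 R) ltr_cos// in_itv/= ?lexx ?(ltW p0)//.
  by apply/andP; split; lra.
have ca0 : 0 <= cos a by apply: cos_ge0_pihalf; apply/andP; split; lra.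
rewrite -Fb -/(F a) (@integration_by_substitution_decreasing _ F _ a (pi - a))//.
- apply: eq_integral => t; rewrite inE/= in_itv/= => /andP[ta tb].
  have st : 0 < sin t by apply: sin_gt0_pi; apply/andP; split; lra.
  rewrite !fctE dFE opprK /arcsine_weighted /F; congr EFin.
  have -> : s * cos t / s = cos t by rewrite mulrC mulKf// gt_eqF.
  rewrite -sin2cos2 sqrtr_sqr gtr0_norm//.
  by field; rewrite gt_eqF.
- move=> x y; rewrite !in_itv/= => /andP[x1 x2] /andP[y1 y2] xy.
  by rewrite /F ltr_pM2l// ltr_cos// in_itv/=; apply/andP; split; lra.
- by apply/cvg_ex; exists (derive1 F a); exact/cvg_at_right_filter/cdF.
- by apply/cvg_ex; exists (derive1 F (pi - a)); exact/cvg_at_left_filter/cdF.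
- by apply: derivable_oo_LRcontinuousT; exact: dF.
- apply: continuous_in_subspaceT => t; rewrite inE/= in_itv/= Fb /F => /andP[t1 t2].
  apply: arcsine_weighted_continuous => //.
  have : s * cos a < s by rewrite gtr_pMr.
  by move=> ?; apply/andP; split; lra.
Qed.

Lemma measurable_arcsine_weighted {R : realType} (s : R) (g : R -> R) :
  0 < s -> continuous g ->
  measurable_fun (`]- s, s[ : set (measurableTypeR R)) (EFin \o arcsine_weighted s g).
Proof.
move=> s0 cg; apply/measurable_EFinP.
apply: subspace_continuous_measurable_fun => //.
apply: continuous_in_subspaceT => t; rewrite inE/= in_itv/= => ts.
exact: arcsine_weighted_continuous.
Qed.

(** Monotone convergence along the truncations at a = pi / (n + 2). *)
Lemma ge0_integral_arcsine_weighted {R : realType} (s : R) (g : R -> R) :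
  0 < s -> continuous g -> (forall t, 0 <= g t) ->
  (\int[@lebesgue_measure R]_(t in `[(- s)%R, s]) (arcsine_weighted s g t)%:E
   = (s * \int[@lebesgue_measure R]_(t in `[0%R, pi]) g (s * cos t))%R%:E)%E.
Proof.
move=> s0 cg g0; have p0 := pi_gt0 R.
have cgs := continuous_comp_scale_cos s g cg.
have csg : continuous (fun t => s * g (s * cos t)).
  by move=> t; apply: cvgMr; exact: cgs.
have mw := measurable_arcsine_weighted s g s0 cg.
have mg (A : set (measurableTypeR R)) :
    measurable_fun A (EFin \o (fun t => s * g (s * cos t))).
  apply/measurable_EFinP; apply: measurable_funTS.
  exact: continuous_measurable_fun.
rewrite -RintegralZl//; last exact: integrable_continuous.
rewrite fineK; last first.
  by apply: integrable_fin_num => //; exact: integrable_continuous.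
rewrite integral_itv_bndoo// [RHS]integral_itv_bndoo; last exact: mg.
pose a (n : nat) : R := pi / n.+2%:R.
have a0 n : 0 < a n by rewrite divr_gt0.
have api n : a n <= pi / 2 by rewrite ler_pM2l// lef_pV2 ?posrE// ler_nat.
have a_le m n : (m <= n)%N -> a n <= a m.
  by move=> mn; rewrite ler_pM2l// lef_pV2 ?posrE// ler_nat.
have a_itv n : a n \in `[0, pi].
  by rewrite in_itv/=; have := a0 n; have := api n => ? ?; apply/andP; split; lra.
have cos_le x y : x \in `[0, pi] -> y \in `[0, pi] -> y <= x -> cos x <= cos y :> R.
  by move=> xp yp; rewrite !leNgt ltr_cos.
have a_lt x : 0 < x -> exists n, forall m, (n <= m)%N -> a m <= x.
  move=> x0; exists (Num.bound (pi / x)) => m nm.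
  rewrite /a ler_pdivrMr// mulrC -ler_pdivrMr//.
  apply: ltW; apply: lt_le_trans (archi_boundP _) _; first by rewrite divr_ge0// ltW.
  by rewrite ler_nat; rewrite (leq_trans nm)// leqW.
pose A n := [set` `[- (s * cos (a n)), s * cos (a n)]].
pose B n := [set` `[a n, pi - a n]].
have UA : \bigcup_n A n = `]- s, s[%classic.
  apply/seteqP; split => t /=.
    move=> [n _]; rewrite /A/= !in_itv/= => /andP[t1 t2].
    have : cos (a n) < 1.
      by rewrite -(@cos0 R) ltr_cos// in_itv/= lexx ltW.
    by rewrite -(ltr_pM2l s0) mulr1 => ?; apply/andP; split; lra.
  rewrite in_itv/= => /andP[t1 t2].
  have u1 : -1 < t / s by rewrite ltr_pdivlMr// mulN1r.
  have u2 : t / s < 1 by rewrite ltr_pdivrMr// mul1r.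
  have x0 : 0 < acos (t / s) by rewrite acos_gt0// ltW.
  have xp : acos (t / s) < pi by rewrite acos_ltpi// u1 ltW.
  have cx : cos (acos (t / s)) = t / s by rewrite acosK// in_itv/= !ltW.
  have [n1 h1] := a_lt _ x0; have [|n2 h2] := a_lt (pi - acos (t / s)).
    by rewrite subr_gt0.
  exists (maxn n1 n2) => //; rewrite /A/= in_itv/=.
  have {}h1 := h1 (maxn n1 n2) (leq_maxl _ _).
  have {}h2 := h2 (maxn n1 n2) (leq_maxr _ _).
  set b := a _ in h1 h2 *; have b_itv : b \in `[0, pi] by exact: a_itv.
  have x_itv : acos (t / s) \in `[0, pi] by rewrite in_itv/= !ltW.
  have : t / s <= cos b by rewrite -cx; exact: cos_le.
  have : - cos b <= t / s.
    rewrite -cx -cosN -cosDpi; apply: cos_le => //; last by lra.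
    by move: b_itv; rewrite !in_itv/= => /andP[? ?]; apply/andP; split; lra.
  rewrite ler_pdivlMr// ler_pdivrMr// mulNr mulrC => ? ?.
  by apply/andP; split; lra.
have UB : \bigcup_n B n = `]0, pi[%classic.
  apply/seteqP; split => t /=.
    move=> [n _]; rewrite /B/= !in_itv/= => /andP[? ?]; have := a0 n => ?.
    by apply/andP; split; lra.
  rewrite in_itv/= => /andP[t0 tp].
  have [n1 h1] := a_lt t t0; have [|n2 h2] := a_lt (pi - t); first lra.
  exists (maxn n1 n2) => //; rewrite /B/= in_itv/= h1 ?leq_maxl//.
  by have := h2 (maxn n1 n2) (leq_maxr _ _) => ?; lra.
have cvgA : (\int[@lebesgue_measure R]_(t in A n) (arcsine_weighted s g t)%:E
    @[n --> \oo] -->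
    \int[@lebesgue_measure R]_(t in `](- s)%R, s[) (arcsine_weighted s g t)%:E)%E.
  rewrite -UA; apply: ge0_nondecreasing_set_cvg_integral.
  - move=> m n mn; apply/subsetPset => t; rewrite /A/= !in_itv/=.
    have : s * cos (a m) <= s * cos (a n).
      by rewrite ler_pM2l//; apply: cos_le => //; exact: a_le.
    by move=> ? /andP[? ?]; apply/andP; split; lra.
  - by move=> n; exact: measurable_itv.
  - move=> n; apply: measurable_funS mw => //; rewrite -UA.
    exact: bigcup_sup.
  - move=> n t _; rewrite lee_fin /arcsine_weighted divr_ge0//.
have cvgB : (\int[@lebesgue_measure R]_(t in B n) (s * g (s * cos t))%:E
    @[n --> \oo] -->
    \int[@lebesgue_measure R]_(t in `]0%R, pi[) (s * g (s * cos t))%:E)%E.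
  rewrite -UB; apply: ge0_nondecreasing_set_cvg_integral.
  - move=> m n mn; apply/subsetPset => t; rewrite /B/= !in_itv/=.
    by have := a_le m n mn => ? /andP[? ?]; apply/andP; split; lra.
  - by move=> n; exact: measurable_itv.
  - by [].
  - by move=> n t _; rewrite lee_fin mulr_ge0// ltW.
apply: (cvg_unique _ cvgA) => //.
have -> // : (fun n => \int[@lebesgue_measure R]_(t in A n) (arcsine_weighted s g t)%:E)%E
    = (fun n => \int[@lebesgue_measure R]_(t in B n) (s * g (s * cos t))%:E)%E.
by apply/funext => n; rewrite /A arcsine_substitution_truncated.
Qed.

(** A bounded function is the difference of a nonnegative one and a constant,
    and both are integrable against the density by the nonnegative case. *)
Lemma integral_arcsine_weighted {R : realType} (s M : R) (g : R -> R) :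
  0 < s -> continuous g -> (forall t, `|g t| <= M) ->
  (\int[@lebesgue_measure R]_(t in `[(- s)%R, s]) (arcsine_weighted s g t)%:E
   = (s * \int[@lebesgue_measure R]_(t in `[0%R, pi]) g (s * cos t))%R%:E)%E.
Proof.
move=> s0 cg gM.
have M0 : 0 <= M by rewrite (le_trans _ (gM 0)).
have cM : continuous (cst M : R -> R) by exact: cst_continuous.
have cgM : continuous (fun t => g t + M) by move=> t; exact: (cvgD (cg t) (cM t)).
have gM0 t : 0 <= g t + M.
  by have := gM t; rewrite ler_norml => /andP[? _]; lra.
have int_ge0 (h : R -> R) : continuous h -> (forall t, 0 <= h t) ->
    (@lebesgue_measure R).-integrable `[(- s)%R, s] (EFin \o arcsine_weighted s h).
  move=> ch h0; apply/integrableP; split.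
    apply: (@emeasurable_fun_itv_cc _ _ _ false true).
    exact: measurable_arcsine_weighted.
  under eq_integral.
    move=> t _ /=; rewrite ger0_norm; last by rewrite divr_ge0.
    over.
  by rewrite ge0_integral_arcsine_weighted// ltry.
transitivity (\int[@lebesgue_measure R]_(t in `[(- s)%R, s])
    ((arcsine_weighted s (fun t => g t + M) t)%:E
     - (arcsine_weighted s (fun=> M) t)%:E))%E.
  by apply: eq_integral => t _; rewrite -EFinB -mulrBl addrK.
rewrite integralB_EFin//; [|exact: int_ge0|exact: int_ge0].
rewrite !ge0_integral_arcsine_weighted// -EFinB -mulrBr -RintegralB//; first last.
- exact: integrable_continuous.
- exact/integrable_continuous/(continuous_comp_scale_cos s _ cgM).
congr (_ * _)%:E; apply: eq_Rintegral => t _.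
by rewrite addrK.
Qed.

(** * The latitude circle theorem *)

Lemma half_angle_formulas {R : realType} (phi : R) : 0 < phi -> phi < pi ->
  let c := cos (phi / 2) in let d := sin (phi / 2) in
  [/\ c ^+ 2 + d ^+ 2 = 1, 0 < c, 0 < d, cos phi = c ^+ 2 - d ^+ 2
    & sin phi = 2 * c * d].
Proof.
move=> p0 ppi c d; split.
- exact: cos2Dsin2.
- by apply: cos_gt0_pihalf; apply/andP; split; lra.
- by apply: sin_gt0_pihalf; apply/andP; split; lra.
- by rewrite [phi]splitr cosD !expr2.
- by rewrite [phi]splitr sinD /c /d; ring.
Qed.

Theorem theorem1p2 (R : realType) (c0 : R) (c0_gt0 : 0 < c0) (c0_lt1 : c0 < 1)
    (phi : R) (phi_gt0 : 0 < phi) (phi_ltpi : phi < pi)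
    (sin_phi : sin phi = c0)
    (f : R -> R) (f_cont : {within `[(-1), 1], continuous f}) :
  ((\int[mu c0_gt0 phi N]_(t in `[(-1)%R, 1%R]) (f t)%:E)%E @[N --> \oo]
   --> ((c0 * pi)^-1)%:E
       * \int[@lebesgue_measure R]_(t in `[(- c0)%R, c0])
           (f t * (1 - (t / c0) ^+ 2) `^ (- 2^-1))%:E)%E.
Proof.
(* Tietze: a continuous bounded extension g of f to the whole line spares
   one-sided continuity at the end points. *)
have [g [M [gf cg gM]]] : exists g : R -> R, exists M : R,
    [/\ forall t, -1 <= t <= 1 -> f t = g t, continuous g & forall t, `|g t| <= M].
  have cpt : compact (`[(-1), 1] : set R) := @segment_compact _ _ _.
  have /compact_bounded[M [_ fM]] := continuous_compact f_cont cpt.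
  have M0 : 0 < Num.max (M + 1) 1 by rewrite lt_max ltr01 orbT.
  have [|||g [fg cg gM]] := continuous_bounded_extension _ _ M0 f_cont.
  - exact: pseudometric_normal.
  - by apply: compact_closed => //; exact: Rhausdorff.
  - by move=> t At; apply: fM; [rewrite lt_max ltrDl ltr01|exists t].
  - exists g, (Num.max (M + 1) 1); split => // t t1.
    by apply: fg; rewrite inE/= in_itv.
(* From here on only the algebraic relations of c and d with phi matter. *)
have [cd1 ch0 dh0 cosE sinE] := half_angle_formulas phi phi_gt0 phi_ltpi.
move: (cos (phi / 2)) (sin (phi / 2)) cd1 ch0 dh0 cosE sinE => c d cd1 ch0 dh0 cosE sinE.
have sphi0 : 0 < sin phi by rewrite sin_phi.
have -> : (((c0 * pi)^-1)%:E * \int[@lebesgue_measure R]_(t in `[(- c0)%R, c0])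
           (f t * (1 - (t / c0) ^+ 2) `^ (- 2^-1))%:E)%E = (arcsine_mean c0 g)%:E.
  transitivity (((c0 * pi)^-1)%:E * \int[@lebesgue_measure R]_(t in `[(- c0)%R, c0])
           (arcsine_weighted c0 g t)%:E)%E.
    congr (_ * _)%E; apply: eq_integral => t; rewrite inE/= in_itv/= => tc.
    rewrite arcsine_weightedE// /arcsine_weighted gf//.
    by case/andP: tc => ? ?; apply/andP; split; lra.
  rewrite (integral_arcsine_weighted c0 M)// -EFinM /arcsine_mean mulrA.
  by congr (_ * _)%:E; rewrite invfM mulrAC mulVf ?mul1r// gt_eqF.
have near_mu : \forall N \near \oo,
    (sph_mean c d N g)%:E = (\int[mu c0_gt0 phi N]_(t in `[(-1)%R, 1%R]) (f t)%:E)%E.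
  near=> N; have N0 : (0 < N)%N by near: N; exact: nbhs_infty_gt.
  transitivity (\int[mu c0_gt0 phi N]_(t in `[(-1)%R, 1%R]) (g t)%:E)%E; last first.
    by apply: eq_integral => t; rewrite inE/= in_itv/= => t1; rewrite gf.
  rewrite integral_mu//; last first.
    by apply: measurable_funTS; exact: continuous_measurable_fun.
  rewrite addn1; congr EFin; apply: eq_bigr => -[k /= kN] _.
  rewrite -{1}sin_phi (latitude_L2norm_order_weight c d)//.
  by rewrite rmorphB/= -!pmulrn.
apply: cvg_trans (near_eq_cvg near_mu) _.
apply: cvg_EFin; first by near=> N.
by rewrite -sin_phi sinE; exact: cvg_sph_mean.
Unshelve. all: by end_near. Qed.
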